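(* Let $X$ be a Tychonoff space, let $\{f_n\}_{n\in\mathbb{N}}$ be a sequence of hard-bounded continuous functions on $X$, and let $f:X\to\mathbb{R}$ be such that $f_n\to f$ uniformly on $X$. Then $f$ is a hard-bounded continuous function on $X$ if and only if for every hard set $H$ in $X$ there exist a sequence of real numbers $\{m_n^{H}\}_{n\in\mathbb{N}}$, a real number $m^{H}$ and an integer $k$ such that $m_n^{H}\le m^{H}$ for all $n\ge k$, $|f_n(x)|\le m_n^{H}$ for all $x\in H$ and all $n$, and $|f(x)|\le m^{H}$ for all $x\in H$.
   Context: All spaces are Tychonoff (completely regular Hausdorff). $\beta X$ and $\upsilon X$ denote the Stone-Čech compactification and Hewitt realcompactification of $X$ ($X\subseteq \upsilon X\subseteq\beta X$). A subset $H\subseteq X$ is hard in $X$ if $H$ is closed in $X\cup K$, where $K=\mathrm{cl}_{\beta X}(\upsilon X\setminus X)$. A continuous function $f:X\to\mathbb{R}$ is hard-bounded if it is bounded on every hard subset of $X$. *)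

(* Defs.v *)
From HB Require Import structures.
From mathcomp Require Import all_boot all_order all_algebra.
From mathcomp Require Import all_classical all_reals all_analysis.

Set Implicit Arguments.
Unset Strict Implicit.
Unset Printing Implicit Defensive.

Import Order.TTheory GRing.Theory Num.Theory.
Import numFieldNormedType.Exports.

Local Open Scope classical_set_scope.
Local Open Scope ring_scope.

Definition tychonoff_space (X : topologicalType) : Prop :=
  hausdorff_space X /\ completely_regular_space X.

Section StoneCech.
Variables (R : realType) (X : topologicalType).

Definition unit_maps : Type :=
  {f : X -> R | continuous f /\ range f `<=` `[0, 1]%classic}.

Local Notation cube :=
  (prod_topology (fun _ : unit_maps => (R : topologicalType))).

Definition cube_map (x : X) : cube := fun f => sval f x.

(* The closure of the image of X in R^unit_maps already lies in
   [0, 1]^unit_maps, so it is the usual model of beta X.  Like every set, it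
   coerces to a type, which carries the topology induced by the product. *)
Definition stone_cech : set cube := closure (range cube_map).

Lemma cube_map_stone_cech (x : X) : cube_map x \in stone_cech.
Proof. by apply/mem_set/subset_closure; exists x. Qed.

Definition to_stone_cech (x : X) : stone_cech :=
  exist _ (cube_map x) (cube_map_stone_cech x).

(* The points p of beta X at which, for every continuous f : X -> R, the
   continuous extension of f from beta X to the one-point compactification of
   R is finite. *)
Definition realcompactification : set stone_cech :=
  [set p | forall f : X -> R, continuous f ->
    exists F : stone_cech -> one_point_compactification R,
      [/\ continuous F, forall x, F (to_stone_cech x) = Some (f x)
        & F p <> None]].

Definition hard_remainder : set stone_cech :=
  closure (realcompactification `\` range to_stone_cech).

Definition hard (H : set X) : Prop :=
  closed (to_stone_cech @` H :
            set (subspace (range to_stone_cech `|` hard_remainder))).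

Definition hard_bounded (f : X -> R) : Prop :=
  forall H : set X, hard H -> [bounded f x | x in H].

End StoneCech.

Arguments hard R {X} H.

(* Main.v *)
Require Import Defs.
From HB Require Import structures.
From mathcomp Require Import all_boot all_order all_algebra.
From mathcomp Require Import all_classical all_reals all_analysis.

Import Order.TTheory GRing.Theory Num.Theory.
Import numFieldNormedType.Exports.

Local Open Scope classical_set_scope.
Local Open Scope ring_scope.

(** Uniform convergence alone gives the continuity of the limit, and a bound
    for [f] on a hard set is literally part of the right-hand condition, so the
    backward implication is immediate.  For the forward one, let [M] bound [f]
    on a hard set [H] and let [k] be a rank from which every [f_ n] is within 1
    of [f].  From that rank on, [M + 1] bounds [f_ n] on [H], by the triangle
    inequality; the finitely many earlier functions keep the individual bounds
    that their own hard-boundedness provides. *)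

Lemma bounded_onP (K : realType) (V : normedModType K) (T : Type) (A : set T)
    (g : T -> V) :
  [bounded g x | x in A] <-> exists M : K, forall x, A x -> `|g x| <= M.
Proof.
split=> [/ex_strict_bound_gt0[M _ gM]|[M gM]].
  by exists M => x /gM /ltW.
by exists M; split; [exact: num_real|move=> N /ltW MN x /gM /le_trans; exact].
Qed.

Lemma uniform_cvg_near_dist (K : realType) (V : normedModType K)
    (T : choiceType) (g_ : nat -> T -> V) (g : T -> V) (e : K) :
  0 < e -> {uniform, g_ @ \oo --> g} ->
  \forall n \near \oo, forall x, `|g x - g_ n x| < e.
Proof.
move=> e0 g_cvg.
apply: (g_cvg [set h | forall x, `|g x - h x| < e]); apply/uniform_nbhs.
exists [set xy | ball xy.1 e xy.2]; split.
  exact: (entourage_ball _ (PosNum e0)).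
by move=> h gh x; have := gh x Logic.I; rewrite /= -ball_normE.
Qed.

(** Past a rank of 1-closeness the bound of [g] enlarged by 1 serves for all
    [g_ n] at once; before it, each [g_ n] is given a bound of its own, chosen
    independently of the others. *)
Lemma uniform_cvg_eventual_bound (K : realType) (V : normedModType K)
    (T : choiceType) (g_ : nat -> T -> V) (g : T -> V) (A : set T) :
  {uniform, g_ @ \oo --> g} ->
  (forall n, [bounded g_ n x | x in A]) -> [bounded g x | x in A] ->
  exists (m_ : nat -> K) (m : K) (k : nat),
    [/\ forall n, (k <= n)%N -> m_ n <= m,
        forall x n, A x -> `|g_ n x| <= m_ n
      & forall x, A x -> `|g x| <= m].
Proof.
move=> g_cvg g_bnd /bounded_onP[M gM].
have /choice[M_ gM_] n : exists Mn, forall x, A x -> `|g_ n x| <= Mn.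
  by apply/bounded_onP.
have [k _ gk] := uniform_cvg_near_dist _ _ _ _ _ _ ltr01 g_cvg.
exists (fun n => if (k <= n)%N then M + 1 else M_ n), (M + 1), k.
split=> [n -> //|x n Ax|x Ax]; last first.
  by rewrite (le_trans (gM x Ax))// lerDl.
case: ifPn => [kn|_]; last exact: gM_.
have -> : g_ n x = g x - (g x - g_ n x) by rewrite subKr.
rewrite (le_trans (ler_normB _ _))// lerD ?gM//.
exact/ltW/gk.
Qed.

Theorem theorem7 (R : realType) (X : topologicalType)
    (tychonoffX : tychonoff_space X)
    (f_ : nat -> X -> R) (f : X -> R)
    (f_hb : forall n, continuous (f_ n) /\ hard_bounded (f_ n))
    (f_cvg : {uniform, f_ @ \oo --> f}) :
  (continuous f /\ hard_bounded f) <->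
  (forall H : set X, hard R H ->
    exists (mH_ : nat -> R) (mH : R) (k : int),
      [/\ forall n : nat, k <= n%:Z -> mH_ n <= mH,
          forall (x : X) (n : nat), H x -> `|f_ n x| <= mH_ n
        & forall x : X, H x -> `|f x| <= mH]).
Proof.
split=> [[_ f_bnd] H hardH|f_dom].
  have [|m_ [m [k [m_le f_le f_m]]]] :=
    uniform_cvg_eventual_bound _ _ _ _ _ _ f_cvg _ (f_bnd H hardH).
    by move=> n; exact: (f_hb n).2.
  by exists m_, m, k%:Z; split=> // n; rewrite lez_nat; exact: m_le.
split.
  apply: (uniform_limit_continuous _ _ f_cvg).
  by near_simpl; apply: nearW => n; exact: (f_hb n).1.
move=> H /f_dom[_ [m [_ [_ _ f_m]]]].
by apply/bounded_onP; exists m.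
Qed.
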